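(* Let $H$ be a hypergraph and let $W\subseteq V(H)$ with $|W|\ge 2$. The set $W$ is a unit in $H$ if and only if $W$ is a maximal set (with respect to inclusion among subsets of $V(H)$) such that $S_W$ is a subspace of the null space of $B_H$.
   Context: A hypergraph $H$ is a pair $(V(H),E(H))$ with $V(H)$ a non-empty finite set (vertices) and $E(H)$ a set of non-empty subsets of $V(H)$ (hyperedges). The edge-vertex incidence matrix $B_H=[b_{ev}]_{e\in E(H),v\in V(H)}$ has $b_{ev}=1$ if $v\in e$ and $b_{ev}=0$ otherwise; for a vector $x:V(H)\to\mathbb{C}$, $(B_Hx)(e)=\sum_{v\in e}x(v)$. For $U\subseteq V(H)$, $S_U=\{x:V(H)\to\mathbb{C} : x(v)=0 \text{ for all } v\in V(H)\setminus U,\ \text{and } \sum_{v\in U}x(v)=0\}$. The star of a vertex $v$ is $E_v(H)=\{e\in E(H): v\in e\}$. A unit in $H$ is an equivalence class of the equivalence relation $\mathcal{R}_u(H)=\{(u,v)\in V(H)\times V(H): E_u(H)=E_v(H)\}$ on $V(H)$. *)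

(* Defs.v *)
From HB Require Import structures.
From mathcomp Require Import all_boot all_order all_algebra.
From mathcomp Require Import reals.
From mathcomp Require Import complex.

Set Implicit Arguments.
Unset Strict Implicit.
Unset Printing Implicit Defensive.

Import GRing.Theory.
Local Open Scope ring_scope.
Local Open Scope complex_scope.

Record hypergraph := Hypergraph {
  vertex :> finType;
  edges : {set {set vertex}};
  vertex_nonempty : (0 < #|vertex|)%N;
  edges_nonempty : set0 \notin edges
}.

Definition star (H : hypergraph) (v : H) : {set {set H}} :=
  [set e in edges H | v \in e].

Definition unit_rel (H : hypergraph) : rel H :=
  fun u v => star u == star v.

Lemma unit_rel_equiv (H : hypergraph) :
  {in [set: H] & &, equivalence_rel (@unit_rel H)}.
Proof.
by move=> u v w _ _ _; split=> [|/eqP uv]; rewrite /unit_rel ?eqxx ?uv.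
Qed.

Definition units (H : hypergraph) : {set {set H}} :=
  equivalence_partition (@unit_rel H) [set: H].

(* The vectors x : V(H) -> C; the regular module R[i]^o is what makes this a
   vectType over the field R[i]. *)
Definition vec (R : realType) (H : hypergraph) : vectType R[i] :=
  {ffun H -> R[i]^o}.

(* Row i is the hyperedge enum_val i, column j the vertex enum_val j. *)
Definition incidence_mx (R : realType) (H : hypergraph) :
    'M[R[i]]_(#|edges H|, #|H|) :=
  \matrix_(i, j) ((enum_val j : H) \in (enum_val i : {set H}))%:R.

Definition incidence_map (R : realType) (H : hypergraph) (x : vec R H) :
    'cV[R[i]]_(#|edges H|) :=
  incidence_mx R H *m \col_(j < #|H|) x (enum_val j).

Fact incidence_map_linear (R : realType) (H : hypergraph) : linear (@incidence_map R H).
Proof.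
move=> a x y; rewrite /incidence_map scalemxAr -mulmxDr; congr (_ *m _).
by apply/matrixP=> i j; rewrite !mxE !ffunE.
Qed.
HB.instance Definition _ (R : realType) (H : hypergraph) :=
  GRing.isLinear.Build R[i] (vec R H)
  'cV[R[i]]_(#|edges H|) _ (@incidence_map R H) (@incidence_map_linear R H).

Definition null_space (R : realType) (H : hypergraph) : {vspace vec R H} :=
  lker (linfun (@incidence_map R H)).

Definition value_at (R : realType) (H : hypergraph) (v : H) (x : vec R H) :
  R[i]^o := x v.

Fact value_at_linear (R : realType) (H : hypergraph) (v : H) : linear (@value_at R H v).
Proof. by move=> a x y; rewrite /value_at !ffunE. Qed.
HB.instance Definition _ (R : realType) (H : hypergraph) (v : H) :=
  GRing.isLinear.Build R[i] (vec R H)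
  R[i]^o _ (@value_at R H v) (@value_at_linear R H v).

Definition sum_over (R : realType) (H : hypergraph) (U : {set H})
  (x : vec R H) : R[i]^o := \sum_(v in U) x v.

Fact sum_over_linear (R : realType) (H : hypergraph) (U : {set H}) : linear (@sum_over R H U).
Proof.
move=> a x y; rewrite /sum_over scaler_sumr -big_split /=.
by apply: eq_bigr => v _; rewrite !ffunE.
Qed.
HB.instance Definition _ (R : realType) (H : hypergraph) (U : {set H}) :=
  GRing.isLinear.Build R[i] (vec R H)
  R[i]^o _ (@sum_over R H U) (@sum_over_linear R H U).

Definition S_ (R : realType) (H : hypergraph) (U : {set H}) :
    {vspace vec R H} :=
  (\bigcap_(v | v \notin U) lker (linfun (@value_at R H v))
   :&: lker (linfun (@sum_over R H U)))%VS.

Lemma incidence_mapE (R : realType) (H : hypergraph) (x : vec R H) (i : 'I_#|edges H|) :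
  incidence_map x i 0 = \sum_(v in (enum_val i : {set H})) x v.
Proof.
rewrite mxE [RHS]big_mkcond /= [RHS](reindex (@enum_val H predT)) /=; last first.
  exact/onW_bij/enum_val_bij.
apply: eq_bigr => j _; rewrite !mxE.
by case: ifP => _; rewrite ?mul1r ?mul0r.
Qed.

Lemma mem_null_spaceP (R : realType) (H : hypergraph) (x : vec R H) :
  reflect (forall e, e \in edges H -> \sum_(v in e) x v = 0)
          (x \in null_space R H).
Proof.
rewrite memv_ker lfunE /=; apply: (iffP eqP) => [x0 e eH | x0].
  have := incidence_mapE x (enum_rank_in eH e).
  by rewrite enum_rankK_in // x0 mxE => /esym.
apply/matrixP => i j; rewrite ord1 incidence_mapE mxE; apply: x0.
exact: enum_valP.
Qed.

Lemma mem_SP (R : realType) (H : hypergraph) (U : {set H}) (x : vec R H) :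
  reflect ((forall v, v \notin U -> x v = 0) /\ \sum_(v in U) x v = 0)
          (x \in S_ R U).
Proof.
rewrite memv_cap memv_ker lfunE /=.
have -> : (x \in (\bigcap_(v | v \notin U) lker (linfun (@value_at R H v)))%VS)
    = [forall (v | v \notin U), x v == 0].
  rewrite memvE; apply/subv_bigcapP/forall_inP => x0 v /x0;
    by rewrite -memvE memv_ker lfunE.
apply: (iffP andP) => [[/forall_inP x0 /eqP sx] | [x0 sx]].
  by split=> // v /x0 /eqP.
by split; [apply/forall_inP => v /x0 /eqP | apply/eqP].
Qed.

(* Main.v *)
Require Import Defs.
From HB Require Import structures.
From mathcomp Require Import all_boot all_order all_algebra.
From mathcomp Require Import reals.
From mathcomp Require Import complex.

(** The inclusion of [S_U] in the null space is a combinatorial condition in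
    disguise: it holds exactly when all vertices of [U] have the same star
    ([S_sub_null_spaceP]). In one direction, the difference of the indicators
    of two vertices [u, v] of [U] belongs to [S_U], and its sum over a
    hyperedge [e] vanishes only if [e] contains both or neither of [u] and [v].
    Conversely, if the star is constant on [U], then every hyperedge contains
    [U] or is disjoint from it, so the sum over a hyperedge of a vector
    supported on [U] is either its total sum or zero.

    The units are by definition the fibres of the star map, and the fibres are
    the maximal nonempty sets on which a map is constant ([unitsP]). *)

Set Implicit Arguments.
Unset Strict Implicit.
Unset Printing Implicit Defensive.

Import GRing.Theory.
Local Open Scope ring_scope.
Local Open Scope complex_scope.

Definition vertex_diff (R : realType) (H : hypergraph) (u v : H) : vec R H :=
  [ffun w => (w == u)%:R - (w == v)%:R : R[i]^o].

Lemma sum_vertex_diff (R : realType) (H : hypergraph) (u v : H) (A : {set H}) :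
  \sum_(w in A) vertex_diff R u v w = (u \in A)%:R - (v \in A)%:R.
Proof.
have sum1 t : \sum_(w in A) ((w == t)%:R : R[i]^o) = (t \in A)%:R.
  rewrite big_mkcond (bigD1 t) //= eqxx big1 ?addr0; first by case: (t \in A).
  by move=> w /negPf->; rewrite if_same.
rewrite -!sum1 -sumrB.
by apply: eq_bigr => w _; rewrite ffunE.
Qed.

Lemma vertex_diff_in_S (R : realType) (H : hypergraph) (U : {set H}) (u v : H) :
  u \in U -> v \in U -> vertex_diff R u v \in S_ R U.
Proof.
move=> uU vU; apply/mem_SP; split=> [w wU|]; last first.
  by rewrite sum_vertex_diff uU vU subrr.
rewrite ffunE; have [wu|_] := eqVneq w u; first by rewrite wu uU in wU.
by have [wv|_] := eqVneq w v; [rewrite wv vU in wU | rewrite subrr].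
Qed.

(** The whole interaction between [S_U] and the incidence matrix is already
    visible on differences of two vertex indicators, each of which compares the
    stars of two vertices, one hyperedge at a time. *)
Lemma S_sub_null_spaceP (R : realType) (H : hypergraph) (U : {set H}) :
  (S_ R U <= null_space R H)%VS <-> {in U &, forall u v, star u = star v}.
Proof.
split=> [/subvP sub u v uU vU | starU].
  apply/setP => e; rewrite !inE; have [eH|//] := boolP (e \in edges H).
  have /mem_null_spaceP/(_ e eH) := sub _ (vertex_diff_in_S R uU vU).
  rewrite sum_vertex_diff /=.
  case: (u \in e); case: (v \in e) => //= /eqP.
    by rewrite subr0 oner_eq0.
  by rewrite sub0r oppr_eq0 oner_eq0.
apply/subvP => x /mem_SP[x0 sx]; apply/mem_null_spaceP => e eH.
have [[u uU ue] | Ue] := altP (@exists_inP _ (mem U) (mem e)).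
  (* [e] contains [u], hence all of [U]. *)
  rewrite -[RHS]sx [RHS]big_mkcond [LHS]big_mkcond /=; apply: eq_bigr => v _.
  have [vU|/x0->] := boolP (v \in U); last by rewrite if_same.
  have: e \in star v by rewrite -(starU u v uU vU) inE eH.
  by rewrite inE => /andP[_ ->].
apply: big1 => v ve; apply: x0; apply: contra Ue => vU.
by apply/exists_inP; exists v.
Qed.

(** A set with constant star lies in the fibre through any of its points, and
    that fibre itself has constant star; so the two coincide exactly when the
    set is maximal. *)
Lemma unitsP (H : hypergraph) (W : {set H}) : W != set0 ->
  W \in units H <->
  {in W &, forall u v, star u = star v} /\
  (forall B : {set H}, {in B &, forall u v, star u = star v} ->
     W \subset B -> B = W).
Proof.
move=> /set0Pn[w wW]; split=> [/imsetP[t _ defW] | [starW maxW]].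
  have inW y : (y \in W) = (star t == star y) by rewrite defW !inE.
  split=> [u v | B starB sWB]; first by rewrite !inW => /eqP<- /eqP.
  apply/eqP; rewrite eqEsubset sWB andbT; apply/subsetP => b bB.
  have tB : t \in B by rewrite (subsetP sWB) // inW.
  by rewrite inW (starB t b).
apply/imsetP; exists w => //; apply/esym/maxW => [u v|].
  by rewrite !inE => /eqP<- /eqP.
by apply/subsetP => y yW; rewrite !inE; apply/eqP/starW.
Qed.

Theorem theorem2p25 (R : realType) (H : hypergraph) (W : {set H})
    (hW : (2 <= #|W|)%N) :
  W \in units H <->
  maxset (fun U : {set H} => (S_ R U <= null_space R H)%VS) W.
Proof.
have W0 : W != set0 by rewrite -card_gt0 ltnW.
split=> [/(unitsP W0)[starW maxW] | /maxsetP[/S_sub_null_spaceP starW maxW]].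
  apply/maxsetP; split=> [|B /S_sub_null_spaceP]; last exact: maxW.
  exact/S_sub_null_spaceP.
by apply/(unitsP W0); split=> // B starB; apply/maxW/S_sub_null_spaceP.
Qed.
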